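(* For any distribution $D$ on $\mathcal X\times\{-1,1\}$, any set $\mathcal H$ of voters $\mathcal X\to[-1,1]$, any prior distribution $P$ on $\mathcal H$ and any $\delta\in(0,1]$, with probability at least $1-\delta$ over $S\sim D^m$, for all posteriors $Q$ on $\mathcal H$, $$\mathrm{kl}\big(\alpha_Q^S\,\|\,\alpha_Q^D\big)\ \le\ \frac1m\Big[2\,\mathrm{KL}(Q\|P)+\ln\frac{\xi(m)}\delta\Big],$$ where $\alpha_Q^{D'}$ denotes any one (the same for $D'=S$ and $D'=D$) of $e_Q^{D'}$, $s_Q^{D'}$, $d_Q^{D'}$.
   Context: $\mathcal L_\ell(a,y)=\tfrac12(1-ya)$ is the linear loss. For a distribution $D'$ on $\mathcal X\times\{-1,1\}$ (for $D'=S$, the uniform distribution on the sample): expected joint error $e_Q^{D'}=\mathbb E_{f_1\sim Q}\mathbb E_{f_2\sim Q}\mathbb E_{(x,y)\sim D'}\mathcal L_\ell(f_1(x),y)\mathcal L_\ell(f_2(x),y)$; expected joint success $s_Q^{D'}=\mathbb E_{f_1,f_2\sim Q}\mathbb E_{D'}[1-\mathcal L_\ell(f_1(x),y)][1-\mathcal L_\ell(f_2(x),y)]$; expected disagreement $d_Q^{D'}=\mathbb E_{f_1,f_2\sim Q}\mathbb E_{x\sim D'_{\mathcal X}}\mathcal L_\ell(f_1(x)f_2(x),1)=\tfrac12(1-\mathbb E_{x}[\mathbb E_{f\sim Q}f(x)]^2)$. $\mathrm{kl}(q\|p)=q\ln\frac qp+(1-q)\ln\frac{1-q}{1-p}$;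 $\mathrm{KL}(Q\|P)=\mathbb E_{f\sim Q}\ln\frac{Q(f)}{P(f)}$; $\xi(m)=\sum_{k=0}^m\binom mk(k/m)^k(1-k/m)^{m-k}$. $S\sim D^m$ i.i.d., $P$ independent of $S$. *)

(* Defs.v *)
From HB Require Import structures.
From mathcomp Require Import all_boot all_order all_algebra.
From mathcomp Require Import all_classical all_reals all_analysis.
Set Implicit Arguments. Unset Strict Implicit. Unset Printing Implicit Defensive.
Import Order.TTheory GRing.Theory Num.Theory.
Import numFieldNormedType.Exports.
Local Open Scope classical_set_scope.
Local Open Scope ring_scope.

Section Defs.
Variable R : realType.

(* labels {-1,1} are encoded by bool: true |-> 1, false |-> -1 *)
Definition lab (b : bool) : R := if b then 1 else -1.

Definition linloss (a y : R) : R := (1 - y * a) / 2.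

(* xi(m) = sum_{k=0}^m C(m,k) (k/m)^k (1-k/m)^(m-k)  (with 0^0 = 1) *)
Definition xi (m : nat) : R :=
  \sum_(k < m.+1) ('C(m, k))%:R * (k%:R / m%:R) ^+ k * (1 - k%:R / m%:R) ^+ (m - k).

Definition kl_term (a b : R) : \bar R :=
  if a == 0 then 0%E else if b == 0 then +oo%E else (a * ln (a / b))%:E.

Definition kl (q p : R) : \bar R := (kl_term q p + kl_term (1 - q) (1 - p))%E.

Context {dH : measure_display} {H : measurableType dH}.

Definition is_density (P Q : probability H R) (q : H -> R) : Prop :=
  [/\ measurable_fun [set: H] q, (forall f, 0 <= q f) &
      forall A, measurable A -> Q A = (\int[P]_(f in A) (q f)%:E)%E].

(* KL(Q||P) = E_{f~Q} ln (dQ/dP)(f) = \int q ln q dP; +oo if Q has no density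
   w.r.t. P (all densities agree P-a.e., so the infimum is just the common value) *)
Definition KL (Q P : probability H R) : \bar R :=
  ereal_inf [set v | exists q, is_density P Q q /\
                       v = (\int[P]_f (q f * ln (q f))%:E)%E].

Context {dX : measure_display} {X : measurableType dX}.

Inductive risk_kind := JointError | JointSuccess | Disagreement.

Definition risk_integrand (h : H -> X -> R) (k : risk_kind) (f1 f2 : H)
    : (X * bool)%type -> R :=
  match k with
  | JointError => fun z =>
      linloss (h f1 z.1) (lab z.2) * linloss (h f2 z.1) (lab z.2)
  | JointSuccess => fun z =>
      (1 - linloss (h f1 z.1) (lab z.2)) * (1 - linloss (h f2 z.1) (lab z.2))
  | Disagreement => fun z => linloss (h f1 z.1 * h f2 z.1) 1
  end.

(* alpha_Q^{D'} = E_{f1~Q} E_{f2~Q} E_{D'}[...], where the expectation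
   operator E of D' is passed as a functional on ((X * bool)%type -> R) *)
Definition alpha (h : H -> X -> R) (k : risk_kind) (Q : probability H R)
    (E : ((X * bool)%type -> R) -> R) : R :=
  fine (\int[Q]_f1 \int[Q]_f2 (E (risk_integrand h k f1 f2))%:E)%E.

Definition expD (D : probability ((X * bool)%type) R) (g : (X * bool)%type -> R) : R :=
  fine (\int[D]_z (g z)%:E)%E.

Definition expS (m : nat) (S : m.-tuple ((X * bool)%type)) (g : (X * bool)%type -> R) : R :=
  (m%:R)^-1 * \sum_(i < m) g (tnth S i).

Local Unset Implicit Arguments.
Fixpoint prodD (D : probability ((X * bool)%type) R) (m : nat)
    : set (m.-tuple ((X * bool)%type)) -> \bar R :=
  match m return set (m.-tuple ((X * bool)%type)) -> \bar R with
  | 0 => fun A => (\1_A [tuple])%:E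
  | m'.+1 => fun A =>
      (\int[D]_z prodD D m' [set t | A (cons_tuple z t)])%E
  end.
Local Set Implicit Arguments.

End Defs.
Arguments prodD {R dX X} D m _.

(* Main.v *)
Require Import Defs.
From HB Require Import structures.
From mathcomp Require Import all_boot all_order all_algebra.
From mathcomp Require Import all_classical all_reals all_analysis.
From mathcomp Require Import measurable_realfun ring lra.
Import Order.TTheory GRing.Theory Num.Theory.
Import numFieldNormedType.Exports.
Local Open Scope classical_set_scope.
Local Open Scope ring_scope.

(** PAC-Bayes with the prior [P \x P] on pairs of voters. For fixed voters the
   empirical mean of the [0,1]-valued joint risk satisfies
   [E exp (m kl(R_S || R_D)) <= xi m] (Maurer), so by Tonelli and Markov
   [\int exp (m kl(R_S || R_D)) d(P x P) <= xi m / delta] with probability at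
   least [1 - delta]. A posterior [Q] enters through the Gibbs variational
   inequality for [Q x Q], whose divergence from [P x P] is [2 KL(Q || P)].

   Both the convexity of [kl] and its infinite values are handled by duality:
   [kl(q || p)] is the supremum over [r, s > 0] of
   [q ln r + (1 - q) ln s + 1 - p r - (1 - p) s], which is affine in [(q, p)].
   Jensen's inequality for [Q x Q] is then linearity of the integral, and in
   Maurer's lemma the exponential of the affine form is a product over the
   sample, bounded factor by factor by its chord on [0,1], i.e. by its value
   for Bernoulli variables with the same means. *)

(** * Variational form of the binary relative entropy *)

Section KlDuality.
Variable R : realType.
Implicit Types (a b q p r s : R) (y : \bar R).

(** For [a, b > 0] this is concave in [r] and reaches its maximum [a * ln (a / b)] at [r = a / b];
    for fixed [r] it is linear in [(a, b)]. *)
Definition kl_term_dual r a b : R := a * ln r + a - b * r.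

Lemma ln_le_sub1 a : 0 < a -> ln a <= a - 1.
Proof.
by move=> a0; have := @le_ln1Dx R (a - 1); rewrite [1 + _]addrC subrK; apply; lra.
Qed.

(** In the regular case this is [ln t <= t - 1] at [t = r * b / a], multiplied by [a]. *)
Lemma kl_term_dual_le r a b : 0 < r -> 0 <= a -> 0 <= b ->
  ((kl_term_dual r a b)%:E <= kl_term a b)%E.
Proof.
move=> r0 a0 b0; rewrite /kl_term /kl_term_dual.
have [->|an0] := eqVneq a 0.
  by rewrite lee_fin !mul0r !add0r oppr_le0 mulr_ge0// ltW.
have [_|bn0] := eqVneq b 0; first by rewrite leey.
have {}a0 : 0 < a by rewrite lt_neqAle eq_sym an0.
have {}b0 : 0 < b by rewrite lt_neqAle eq_sym bn0.
rewrite lee_fin.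
have := @ln_le_sub1 (r * b / a) (divr_gt0 (mulr_gt0 r0 b0) a0).
rewrite !(ln_div, lnM) ?posrE ?mulr_gt0// => /(ler_wpM2l (ltW a0)).
have -> : a * (r * b / a - 1) = r * b - a by field.
lra.
Qed.

(** The regular case tests the optimal [r = a / b]. If [a = 0] the supremum is approached as [r]
    tends to 0, and if [b = 0 < a] as [r] tends to infinity, so a suitable [r] is chosen from
    [y]. *)
Lemma kl_term_le_dual a b y : 0 <= a -> 0 <= b ->
  (forall r, 0 < r -> ((kl_term_dual r a b)%:E <= y)%E) -> (kl_term a b <= y)%E.
Proof.
move=> a0 b0 H; rewrite /kl_term.
have [az|an0] := eqVneq a 0.
  move: H; rewrite az; case: y => [y| |] H; last 2 first.
  - by rewrite leey.
  - by have := H 1 ltr01.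
  rewrite lee_fin leNgt; apply/negP => y0.
  have b1 : 0 < b + 1 by lra.
  (* If [y < 0], this [r] gives [b * r < - y], against [- (b * r) <= y]; the shift [b + 1] also
     covers [b = 0]. *)
  have r0 : 0 < - y / (b + 1) by rewrite divr_gt0// oppr_gt0.
  have := H _ r0; rewrite lee_fin /kl_term_dual !mul0r !add0r mulrCA.
  rewrite -[leRHS]opprK lerN2 -[leLHS]mulr1 ler_pM2l ?oppr_gt0//.
  by rewrite ler_pdivlMr//; lra.
have {an0}a0 : 0 < a by rewrite lt_neqAle eq_sym an0.
have [bz|bn0] := eqVneq b 0.
  move: H; rewrite bz; case: y => [y| |] H //; last by have := H 1 ltr01.
  (* At this [r] the dual form equals [y + a], which exceeds [y]. *)
  have := H _ (expR_gt0 (y / a)); rewrite lee_fin /kl_term_dual expRK mul0r.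
  by rewrite (mulrC a) divfK ?gt_eqF// => h; exfalso; lra.
have {bn0}b0 : 0 < b by rewrite lt_neqAle eq_sym bn0.
have := H _ (divr_gt0 a0 b0); rewrite /kl_term_dual (mulrC b) divfK ?gt_eqF//.
by rewrite addrK.
Qed.

Lemma kl_term_gtNy a b : (-oo < kl_term a b)%E.
Proof. by rewrite /kl_term; case: ifP => // _; case: ifP => // _; rewrite ltNyr. Qed.

Definition kl_dual r s q p : R :=
  kl_term_dual r q p + kl_term_dual s (1 - q) (1 - p).

Lemma kl_dual_le r s q p : 0 < r -> 0 < s -> 0 <= q <= 1 -> 0 <= p <= 1 ->
  ((kl_dual r s q p)%:E <= kl q p)%E.
Proof.
move=> r0 s0 /andP[q0 q1] /andP[p0 p1].
by rewrite /kl_dual EFinD leeD// kl_term_dual_le// subr_ge0.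
Qed.

(** The parameters [r] and [s] are independent, so the supremum is taken over [r] with [s] fixed,
    and then over [s]. *)
Lemma kl_le_dual q p y : 0 <= q <= 1 -> 0 <= p <= 1 ->
  (forall r s, 0 < r -> 0 < s -> ((kl_dual r s q p)%:E <= y)%E) ->
  (kl q p <= y)%E.
Proof.
move=> /andP[q0 q1] /andP[p0 p1] H; rewrite /kl.
have {}H s : 0 < s ->
    (kl_term q p <= y - (kl_term_dual s (1 - q) (1 - p))%:E)%E.
  move=> s0; apply: kl_term_le_dual => // r r0.
  by rewrite leeBrDr//; exact: H.
have := kl_term_gtNy q p.
case E : (kl_term q p) => [t| |]// _.
  rewrite addeC -leeBrDr//; apply: kl_term_le_dual; rewrite ?subr_ge0// => s s0.
  by rewrite leeBrDr// addeC -leeBrDr// -E; exact: H.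
(* When the first term is [+oo], a single [s] suffices: [y] minus a finite number is [+oo], hence so
   is [y]. *)
have := H 1 ltr01; rewrite E leye_eq => /eqP.
by case: y {H} => [y| |]//; rewrite ?leey.
Qed.

(** Weighted AM-GM inequality: the tangent to [expR] at the mean [v] of the logarithms lies below
    both points, and the first-order terms cancel in the average. *)
Lemma expR_conv_le x r s : 0 <= x <= 1 -> 0 < r -> 0 < s ->
  expR (x * ln r + (1 - x) * ln s) <= x * r + (1 - x) * s.
Proof.
move=> /andP[x0 x1] r0 s0; set v := (X in expR X).
have tan t : 0 < t -> expR v * (1 + (ln t - v)) <= t.
  move=> t0; rewrite [leRHS](_ : t = expR v * expR (ln t - v)); last first.
    by rewrite -expRD addrC subrK lnK.
  by rewrite ler_wpM2l ?expR_ge0// expR_ge1Dx.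
have hr := ler_wpM2l x0 (tan _ r0).
have h1x : 0 <= 1 - x by rewrite subr_ge0.
have hs := ler_wpM2l h1x (tan _ s0).
apply: le_trans (lerD hr hs).
rewrite le_eqVlt; apply/orP; left; apply/eqP.
rewrite /v; ring.
Qed.

(** The exponential turns [b ^+ k] into [(k / m) ^+ k], with equality unless [b = 0 < k]. In that
    case the left side is [0 * +oo], which is 0. *)
Lemma expeR_kl_term_le m k b : (k <= m)%N -> (0 < m)%N -> 0 <= b ->
  ((b ^+ k)%:E * expeR (m%:R%:E * kl_term (k%:R / m%:R) b)
   <= ((k%:R / m%:R) ^+ k)%:E)%E.
Proof.
move=> km m0 b0; have m0R : (0 < m%:R :> R) by rewrite ltr0n.
case: k km => [|k] km; first by rewrite !expr0 mul0r /kl_term eqxx mule0 expeR0 mule1.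
have k0 : (0 < k.+1%:R / m%:R :> R) by rewrite divr_gt0.
rewrite /kl_term gt_eqF//.
have [->|bn0] := eqVneq b 0; first by rewrite expr0n mul0e lee_fin exprn_ge0// ltW.
have {bn0}b0 : 0 < b by rewrite lt_neqAle eq_sym bn0.
rewrite /= lee_fin mulrA (mulrC m%:R) divfK ?gt_eqF// expRM_natl lnK ?posrE ?divr_gt0//.
by rewrite -exprMn mulrC divfK ?gt_eqF.
Qed.

End KlDuality.

(** * Expectations under independent Bernoulli variables *)

Section BernoulliMixture.
Variable R : realType.
Implicit Types (xs : seq R) (c : nat -> \bar R) (p q r s : R).

(* E[c (B_1 + ... + B_n)] for independent Bernoulli variables B_i of means xs_i. *)
Fixpoint bern_mix xs c : \bar R :=
  if xs is x :: xs' then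
    (x%:E * bern_mix xs' (c \o succn) + (1 - x)%:E * bern_mix xs' c)%E
  else c 0%N.

Lemma bern_mix_ge0 xs c : {in xs, forall x, 0 <= x <= 1} ->
  (forall k, (0 <= c k)%E) -> (0 <= bern_mix xs c)%E.
Proof.
elim: xs c => [|x xs IH] c xs01 c0 //=.
have /andP[x0 x1] : 0 <= x <= 1 by apply: xs01; rewrite mem_head.
have {}IH c' : (forall k, (0 <= c' k)%E) -> (0 <= bern_mix xs c')%E.
  by apply: IH => t txs; apply: xs01; rewrite in_cons txs orbT.
by apply: adde_ge0; apply: mule_ge0; rewrite ?lee_fin ?subr_ge0//;
  apply: IH => // k; apply: c0.
Qed.

(** For [c k = C * r ^+ k * s ^+ (n - k)] the mixture factors into the product of the chords
    [x * r + (1 - x) * s], each bounded below by AM-GM. The constant [C] collects the factors [r]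
    and [s] of the entries already processed. *)
Lemma bern_mix_lower xs c r s (C : R) : {in xs, forall x, 0 <= x <= 1} ->
    0 < r -> 0 < s -> 0 <= C ->
    (forall k, (k <= size xs)%N -> ((C * r ^+ k * s ^+ (size xs - k))%:E <= c k)%E) ->
  ((C * expR (\sum_(x <- xs) (x * ln r + (1 - x) * ln s)))%:E
   <= bern_mix xs c)%E.
Proof.
move=> + r0 s0; elim: xs c C => [|x xs IH] c C xs01 C0 Hc /=.
  by rewrite big_nil expR0 mulr1; have := Hc _ (leqnn _); rewrite !mulr1.
have x01 : 0 <= x <= 1 by apply: xs01; rewrite mem_head.
have /andP[x0 x1] := x01.
have {}IH := IH _ _ (fun t txs => xs01 t (mem_behead (s := x :: xs) txs)).
rewrite big_cons expRD; set T := expR (\sum_(_ <- _) _).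
apply: (@le_trans _ _ (x * (C * r * T) + (1 - x) * (C * s * T))%:E).
  rewrite lee_fin [leRHS](_ : _ = C * ((x * r + (1 - x) * s) * T)); last by ring.
  by rewrite ler_wpM2l// ler_wpM2r ?expR_ge0// expR_conv_le.
rewrite EFinD !(EFinM x) !(EFinM (1 - x)).
apply: leeD; apply: lee_wpmul2l; rewrite ?lee_fin ?subr_ge0//.
- apply: IH => [|k kn]; first by rewrite mulr_ge0// ltW.
  by have := Hc k.+1 kn; rewrite /= subSS exprS !mulrA.
- apply: IH => [|k kn]; first by rewrite mulr_ge0// ltW.
  by have := Hc k (leqW kn); rewrite /= subSn// exprS mulrACA -mulrA !mulrA.
Qed.

(** With equal means the mixture is a binomial expectation; [C] accumulates the probability of the
    draws already made. The weight is kept together with [c k], since [c k] may be [+oo] where the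
    weight is zero. *)
Lemma bern_mix_nseq_upper n p c (d : nat -> R) (C : R) : 0 <= p <= 1 ->
    0 <= C -> (forall k, (0 <= c k)%E) ->
    (forall k, (k <= n)%N ->
      ((C * p ^+ k * (1 - p) ^+ (n - k))%:E * c k <= (d k)%:E)%E) ->
  (C%:E * bern_mix (nseq n p) c <= (\sum_(k < n.+1) 'C(n, k)%:R * d k)%:E)%E.
Proof.
move=> /andP[p0 p1]; have q0 : 0 <= 1 - p by rewrite subr_ge0.
elim: n c d C => [|n IH] c d C C0 c0 Hd /=.
  by rewrite big_ord1 bin0 mul1r; have := Hd _ (leqnn _); rewrite !mulr1.
have b0 c' : (forall k, (0 <= c' k)%E) -> (0 <= bern_mix (nseq n p) c')%E.
  by apply: bern_mix_ge0 => x; rewrite mem_nseq => /andP[_ /eqP->]; rewrite p0.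
rewrite ge0_muleDr; last 2 first.
- by apply: mule_ge0; rewrite ?lee_fin// b0// => k; apply: c0.
- by apply: mule_ge0; rewrite ?lee_fin// b0.
rewrite !muleA -!EFinM.
have IH1 := IH (c \o succn) (d \o succn) (C * p) (mulr_ge0 C0 p0) (fun k => c0 k.+1).
have IH2 := IH c d (C * (1 - p)) (mulr_ge0 C0 q0) c0.
apply: le_trans (leeD (IH1 _) (IH2 _)) _ => [k kn|k kn|].
- by have := Hd k.+1 kn; rewrite /= subSS exprS !mulrA.
- have := Hd k (leqW kn); rewrite subSn// exprS.
  by rewrite -!mulrA [X in (C * X)%R]mulrCA.
rewrite -EFinD lee_fin le_eqVlt; apply/orP; left; apply/eqP.
(* Pascal's rule recombines the two branches; the surplus top term carries ['C(n, n.+1) = 0]. *)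
rewrite [in RHS]big_ord_recl /= bin0 mul1r.
under [in RHS]eq_bigr do rewrite /bump /= add1n binS natrD mulrDl.
rewrite big_split/= addrA [RHS]addrC; congr (_ + _).
rewrite [in LHS]big_ord_recl /= bin0 mul1r [in RHS]big_ord_recr /= bin_small//.
by rewrite mul0r addr0.
Qed.

(** At [q = k / m] the exponential of this form is a constant times [r ^+ k * s ^+ (m - k)], as
    [bern_mix_lower] requires. *)
Lemma mul_kl_dualE m r s q p :
  m%:R * kl_dual R r s q p
  = m%:R * (1 - p * r - (1 - p) * s) + m%:R * q * ln r + (m%:R - m%:R * q) * ln s.
Proof. by rewrite /kl_dual /kl_term_dual; ring. Qed.

(** For each fixed [r, s] the exponential of the affine form is at most the mixture [B], which does
    not depend on [r, s]; duality then passes to the supremum. *)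
Lemma expeR_kl_le_bern_mix m xs p : size xs = m -> (0 < m)%N -> 0 <= p <= 1 ->
    {in xs, forall x, 0 <= x <= 1} ->
  (expeR (m%:R%:E * kl (m%:R^-1 * \sum_(x <- xs) x) p)
   <= bern_mix xs (fun k => expeR (m%:R%:E * kl (k%:R / m%:R) p)))%E.
Proof.
move=> szm m_gt0 p01 xs01; set q := _^-1 * _; set B := bern_mix _ _.
have m0 : 0 < m%:R :> R by rewrite ltr0n.
have mq : m%:R * q = \sum_(x <- xs) x by rewrite mulrA divff ?gt_eqF// mul1r.
have q01 : 0 <= q <= 1.
  have h : 0 <= \sum_(x <- xs) x <= m%:R.
    rewrite -szm; elim: (xs) xs01 => [|x t IH] H; first by rewrite big_nil lexx.
    rewrite big_cons /=.
    have := H x (mem_head _ _).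
    have := IH (fun y yt => H y (mem_behead (s := x :: t) yt)).
    by rewrite -natr1; lra.
  by rewrite -(ler_pM2l m0) mulr0 -[X in _ && X](ler_pM2l m0) mulr1 mq.
have low r s : 0 < r -> 0 < s -> ((expR (m%:R * kl_dual R r s q p))%:E <= B)%E.
  move=> r0 s0.
  have -> : expR (m%:R * kl_dual R r s q p) =
      expR (m%:R * (1 - p * r - (1 - p) * s)) *
      expR (\sum_(x <- xs) (x * ln r + (1 - x) * ln s)).
    rewrite -expRD mul_kl_dualE -addrA mq; congr (expR (_ + _)).
    rewrite big_split/= -!mulr_suml; congr (_ + _ * _).
    by rewrite sumrB -szm -sum1_size natr_sum.
  apply: bern_mix_lower => // k.
  rewrite szm => km.
  have km01 : 0 <= (k%:R / m%:R : R) <= 1.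
    by rewrite divr_ge0//= ler_pdivrMr// mul1r ler_nat.
  rewrite (@le_trans _ _ (expeR (m%:R * kl_dual R r s (k%:R / m%:R) p)%:E))//; last first.
    by rewrite lee_expeR EFinM lee_wpmul2l ?lee_fin ?ler0n// kl_dual_le.
  rewrite /= lee_fin mul_kl_dualE mulrCA divff ?gt_eqF// mulr1 -natrB//.
  by rewrite !expRD !expRM_natl !lnK.
(* Any one pair [r, s] shows [B > 0], so a finite [B] has a logarithm and duality applies with the
   bound [ln B / m]. *)
have := low 1 1 ltr01 ltr01; move: low; case: B => [B| |] low //; last by move=> _; rewrite leey.
rewrite lee_fin => /(lt_le_trans (expR_gt0 _)) B0.
rewrite -(lnK B0) -/(expeR (ln B)%:E) lee_expeR -lee_pdivlMl//.
apply: kl_le_dual => // r s r0 s0; rewrite -EFinM lee_fin ler_pdivlMl//.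
by rewrite -ler_expR lnK// -lee_fin low.
Qed.

End BernoulliMixture.

Lemma integral_cst_prob (R : realType) (d : measure_display)
    (T : measurableType d) (P : probability T R) (y : \bar R) :
  (\int[P]_x y = y)%E.
Proof.
rewrite (integral_cst _ measurableT y).
by rewrite -[RHS]mule1; congr (_ * _)%E; exact: probability_setT.
Qed.

(** * The law of an i.i.d. sample *)

Section IidSample.
Context {R : realType} {d : measure_display} {T : measurableType d}.
Implicit Types (D : probability T R).

Definition cons_pair n (zt : T * n.-tuple T) : n.+1.-tuple T :=
  cons_tuple zt.1 zt.2.

Lemma measurable_cons_pair n :
  measurable_fun [set: (T * n.-tuple T)%type] (@cons_pair n).
Proof. exact: (measurable_cons measurable_fst measurable_snd). Qed.

HB.instance Definition _ n :=
  isMeasurableFun.Build _ _ _ _ (@cons_pair n) (@measurable_cons_pair n).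

(** The same law as [prodD], built as a bundled [probability] so that Tonelli and Markov apply to
    it. *)
Fixpoint iid D n : probability (n.-tuple T) R :=
  if n is n'.+1 then distribution (D \x iid D n')%E (@cons_pair n')
  else dirac [tuple].

Lemma ge0_integral_iidS D n (f : n.+1.-tuple T -> \bar R) :
    measurable_fun [set: n.+1.-tuple T] f -> (forall t, (0 <= f t)%E) ->
  (\int[iid D n.+1]_t f t = \int[D]_z \int[iid D n]_t f (cons_tuple z t))%E.
Proof.
move=> mf f0 /=; rewrite ge0_integral_distribution//.
rewrite (fubini_tonelli1 (f \o @cons_pair n))//; last by move=> t; exact: f0.
by apply: measurableT_comp => //; exact: measurable_cons_pair.
Qed.

Lemma measurable_bern_mix n (g : T -> R) (c : nat -> \bar R) :
  measurable_fun [set: T] g ->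
  measurable_fun [set: n.-tuple T] (fun t => bern_mix R (map g t) c).
Proof.
move=> mg; elim: n c => [|n IH] c.
  by apply: (eq_measurable_fun (cst (c 0%N))) => // t _; rewrite tuple0.
apply: (eq_measurable_fun (fun t : n.+1.-tuple T =>
  ((g (tnth t ord0))%:E * bern_mix R (map g [tuple of behead t]) (c \o succn) +
   (1 - g (tnth t ord0))%:E * bern_mix R (map g [tuple of behead t]) c)%E)).
  by move=> t _; rewrite [t in RHS]tuple_eta.
have mg0 : measurable_fun [set: n.+1.-tuple T] (fun t => g (tnth t ord0)).
  by apply: measurableT_comp => //; exact: measurable_tnth.
apply: emeasurable_funD; apply: emeasurable_funM.
- exact/measurable_EFinP.
- by apply: (measurableT_comp (IH _)); exact: measurable_behead.
- by apply/measurable_EFinP; apply: measurable_funB.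
- by apply: (measurableT_comp (IH _)); exact: measurable_behead.
Qed.

(** The mixture is affine in each mean separately and the sample points are independent, so
    integration replaces every [g z] by its expectation. *)
Lemma integral_bern_mix D n (g : T -> R) (c : nat -> \bar R) :
    measurable_fun [set: T] g -> (forall z, 0 <= g z <= 1) ->
    (forall k, (0 <= c k)%E) ->
  (\int[iid D n]_t bern_mix R (map g t) c
   = bern_mix R (nseq n (fine (\int[D]_z (g z)%:E))) c)%E.
Proof.
move=> mg g01 c0; set p := fine _.
have g0 z : 0 <= g z by case/andP: (g01 z).
have g1 z : 0 <= 1 - g z by case/andP: (g01 z); rewrite subr_ge0.
have mEg : measurable_fun [set: T] (fun z => (g z)%:E) by exact/measurable_EFinP.
have mE1g : measurable_fun [set: T] (fun z => (1 - g z)%:E).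
  by apply/measurable_EFinP; apply: measurable_funB.
have gfin : (\int[D]_z (g z)%:E \is a fin_num)%E.
  rewrite ge0_fin_numE; last by apply: integral_ge0 => z _; rewrite lee_fin.
  apply: (@le_lt_trans _ _ (\int[D]_z (cst 1 z))%E).
    by apply: ge0_le_integral => // z _; rewrite lee_fin; case/andP: (g01 z).
  by rewrite integral_cst_prob ltry.
have Eg : (\int[D]_z (g z)%:E = p%:E)%E by rewrite fineK.
have E1g : (\int[D]_z (1 - g z)%:E = (1 - p)%:E)%E.
  have h : (\int[D]_z ((1 - g z)%:E + (g z)%:E) = 1)%E.
    under eq_integral do rewrite -EFinD subrK.
    by rewrite integral_cst_prob.
  move: h; rewrite ge0_integralD//; [|by move=> z _; rewrite lee_fin..].
  by rewrite Eg => /(congr1 (fun x => (x - p%:E)%E)); rewrite addeK.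
have B0 k (t : k.-tuple T) c' : (forall k, (0 <= c' k)%E) -> (0 <= bern_mix R (map g t) c')%E.
  by apply: bern_mix_ge0 => x /mapP[z _ ->].
have p01 : 0 <= p <= 1.
  rewrite fine_ge0 ?integral_ge0//=; last by move=> z _; rewrite lee_fin.
  by rewrite -subr_ge0 -lee_fin -E1g integral_ge0// => z _; rewrite lee_fin.
have b0 k c' : (forall k, (0 <= c' k)%E) -> (0 <= bern_mix R (nseq k p) c')%E.
  by apply: bern_mix_ge0 => x; rewrite mem_nseq => /andP[_ /eqP->].
elim: n c c0 => [|n IH] c c0.
  by rewrite integral_dirac//= ?diracT ?mul1e//; exact: (@measurable_bern_mix 0).
rewrite ge0_integral_iidS//; [|exact: measurable_bern_mix|by move=> t; exact: B0].
have c0' k : (0 <= (c \o succn) k)%E by exact: c0.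
have mB (a : R) c' : measurable_fun [set: n.-tuple T]
    (fun t => a%:E * bern_mix R (map g t) c')%E.
  by apply: emeasurable_funM => //; exact: measurable_bern_mix.
have inner z : (\int[iid D n]_t bern_mix R (map g (cons_tuple z t)) c =
    (g z)%:E * bern_mix R (nseq n p) (c \o succn) +
    (1 - g z)%:E * bern_mix R (nseq n p) c)%E.
  rewrite /= ge0_integralD//; try by move=> t _; rewrite mule_ge0 ?lee_fin ?B0.
  rewrite !ge0_integralZl ?lee_fin ?IH//; try exact: measurable_bern_mix.
    by move=> t _; rewrite B0.
  by move=> t _; rewrite B0.
under eq_integral do rewrite inner.
rewrite ge0_integralD//; first last.
- by apply: emeasurable_funM.
- by move=> t _; rewrite mule_ge0 ?lee_fin ?b0.
- by apply: emeasurable_funM.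
- by move=> t _; rewrite mule_ge0 ?lee_fin ?b0.
rewrite !ge0_integralZr ?b0//; first by rewrite Eg E1g.
all: by move=> z _; rewrite lee_fin.
Qed.

End IidSample.

(** * Agreement with the sample law of the statement *)

Section IidLabelled.
Context {R : realType} {dX : measure_display} {X : measurableType dX}.
Variable D : probability ((X * bool)%type) R.

(** A product measure integrates the measures of the sections, which is the recursion of [prodD];
    measurable sections keep the induction going. *)
Lemma prodD_iid n (A : set (n.-tuple (X * bool)%type)) : measurable A ->
  prodD D n A = iid D n A.
Proof.
elim: n A => [|n IH] A mA; first by rewrite /= diracE.
rewrite /= /distribution /pushforward /= /product_measure1.
apply: eq_integral => z _ /=.
have -> : [set t | A (cons_tuple z t)] = xsection (@cons_pair _ _ n @^-1` A) z.
  by apply/seteqP; split => t; rewrite /xsection/= inE.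
rewrite IH//; apply: measurable_xsection.
by rewrite -[X in measurable X]setTI; exact: measurable_cons_pair.
Qed.

End IidLabelled.

(** * Measurability of [kl] and of its exponential *)

Section KlMeasurability.
Context {R : realType} {d : measure_display} {T : measurableType d}.
Implicit Types u v : T -> R.

Lemma measurable_kl_term u v :
    measurable_fun [set: T] u -> measurable_fun [set: T] v ->
    (forall x, 0 <= u x) -> (forall x, 0 <= v x) ->
  measurable_fun [set: T] (fun x => kl_term (u x) (v x)).
Proof.
move=> mu mv u0 v0.
apply: (eq_measurable_fun (fun x => if u x == 0 then 0%E else
  if v x == 0 then +oo%E else (u x * (ln (u x) - ln (v x)))%:E)).
  move=> x _; rewrite /kl_term; case: ifPn => // un0; case: ifPn => // vn0.
  by rewrite ln_div// posrE lt_neqAle eq_sym ?un0 ?vn0 ?u0 ?v0.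
apply: measurable_fun_ifT => //; first exact: measurable_fun_eqr.
apply: measurable_fun_ifT => //; first exact: measurable_fun_eqr.
apply/measurable_EFinP; apply: measurable_funM => //.
by apply: measurable_funB; exact: measurableT_comp.
Qed.

Lemma measurable_kl u v :
    measurable_fun [set: T] u -> measurable_fun [set: T] v ->
    (forall x, 0 <= u x <= 1) -> (forall x, 0 <= v x <= 1) ->
  measurable_fun [set: T] (fun x => kl (u x) (v x)).
Proof.
move=> mu mv u01 v01; apply: emeasurable_funD; apply: measurable_kl_term => //.
- by move=> x; case/andP: (u01 x).
- by move=> x; case/andP: (v01 x).
- exact: measurable_funB.
- exact: measurable_funB.
- by move=> x; case/andP: (u01 x); rewrite subr_ge0.
- by move=> x; case/andP: (v01 x); rewrite subr_ge0.
Qed.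

Lemma measurable_fun_expeR (f : T -> \bar R) :
  measurable_fun [set: T] f -> measurable_fun [set: T] (fun x => expeR (f x)).
Proof.
move=> mf.
apply: (eq_measurable_fun (fun x => if f x == +oo%E then +oo%E else
  if f x == -oo%E then 0%E else (expR (fine (f x)))%:E)).
  by move=> x _; case: (f x).
apply: measurable_fun_ifT => //; first exact: measurable_fun_eqe.
apply: measurable_fun_ifT => //; first exact: measurable_fun_eqe.
apply/measurable_EFinP; apply: measurableT_comp => //.
by apply: measurableT_comp => //; exact: fine_measurable.
Qed.

End KlMeasurability.

Lemma xi_ge1 (R : realType) m : (0 < m)%N -> 1 <= xi R m.
Proof.
move=> m0; rewrite /xi big_ord_recl /= bin0 expr0 mul0r subr0 expr1n !mulr1.
rewrite lerDl; apply: sumr_ge0 => k _.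
apply: mulr_ge0; first by rewrite mulr_ge0// exprn_ge0// divr_ge0.
rewrite exprn_ge0//.
by rewrite subr_ge0 ler_pdivrMr ?ltr0n// mul1r ler_nat.
Qed.

(** * Maurer's exponential moment bound *)

Section MaurerBound.
Context {R : realType} {d : measure_display} {T : measurableType d}.
Variables (D : probability T R) (m : nat) (m_gt0 : (0 < m)%N).

Lemma mean01 (g : T -> R) : measurable_fun [set: T] g ->
  (forall z, 0 <= g z <= 1) -> 0 <= fine (\int[D]_z (g z)%:E) <= 1.
Proof.
move=> mg g01.
have g0 : (0 <= \int[D]_z (g z)%:E)%E.
  by apply: integral_ge0 => z _; rewrite lee_fin; case/andP: (g01 z).
have g1 : (\int[D]_z (g z)%:E <= 1)%E.
  rewrite -[leRHS](integral_cst_prob R d T D); apply: ge0_le_integral => //.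
  - by move=> z _; rewrite lee_fin; case/andP: (g01 z).
  - exact/measurable_EFinP.
  - by move=> z _; rewrite lee_fin; case/andP: (g01 z).
rewrite fine_ge0//= -lee_fin fineK// ge0_fin_numE//.
by apply: le_lt_trans g1 _; rewrite ltry.
Qed.

Lemma sample_mean01 (g : T -> R) (t : m.-tuple T) :
  (forall z, 0 <= g z <= 1) -> 0 <= m%:R^-1 * \sum_(i < m) g (tnth t i) <= 1.
Proof.
move=> g01; have m0 : 0 < m%:R :> R by rewrite ltr0n.
rewrite mulr_ge0 ?invr_ge0 ?ler0n ?sumr_ge0//=; last by move=> i _; case/andP: (g01 (tnth t i)).
rewrite mulrC ler_pdivrMr// mul1r.
have -> : m%:R = \sum_(i < m) (1 : R) by rewrite sumr_const card_ord.
by apply: ler_sum => i _; case/andP: (g01 (tnth t i)).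
Qed.

(** The integral is dominated by that of a Bernoulli mixture, hence by a binomial expectation of
    mean [p]. There the exponential of [m * kl (k / m) p] cancels the likelihood of [k] successes
    and leaves the summands of [xi]. *)
Lemma integral_expeR_kl_le (g : T -> R) : measurable_fun [set: T] g ->
    (forall z, 0 <= g z <= 1) ->
  (\int[iid D m]_t expeR (m%:R%:E * kl (m%:R^-1 * \sum_(i < m) g (tnth t i))
                                      (fine (\int[D]_z (g z)%:E)))
   <= (xi R m)%:E)%E.
Proof.
move=> mg g01; set p := fine _; have p01 := mean01 _ mg g01.
pose c k := expeR (m%:R%:E * kl (k%:R / m%:R) p).
have c0 k : (0 <= c k)%E by exact: expeR_ge0.
apply: (@le_trans _ _ (\int[iid D m]_t bern_mix R (map g t) c)%E).
  apply: ge0_le_integral => //.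
  - by move=> t _; exact: expeR_ge0.
  - apply: measurable_fun_expeR; apply: emeasurable_funM => //.
    apply: measurable_kl => // [|t]; last exact: sample_mean01.
    apply: measurable_funM => //; apply: measurable_sum => i.
    by apply: measurableT_comp => //; exact: measurable_tnth.
  - exact: measurable_bern_mix.
  - move=> t _; rewrite (_ : \sum_(i < m) _ = \sum_(x <- map g t) x); last first.
      by rewrite big_map big_tuple.
    apply: expeR_kl_le_bern_mix => //; first by rewrite size_map size_tuple.
    by move=> x /mapP[z _ ->].
rewrite integral_bern_mix// -/p -[leLHS]mul1e.
apply: le_trans (@bern_mix_nseq_upper R m p c
  (fun k => (k%:R / m%:R) ^+ k * (1 - k%:R / m%:R) ^+ (m - k)) 1 p01 ler01 c0 _) _.
  move=> k km; rewrite mul1r.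
  have [p0 p1] := andP p01.
  have m0 : m%:R != 0 :> R by rewrite pnatr_eq0 -lt0n.
  have -> : 1 - k%:R / m%:R = (m - k)%:R / m%:R :> R by rewrite natrB//; field.
  rewrite /c /kl.
  have -> : 1 - k%:R / m%:R = (m - k)%:R / m%:R :> R by rewrite natrB//; field.
  (* The sum of the two terms is well defined because neither is [-oo]; successes and failures are
     then bounded separately. *)
  rewrite muleDr//; last by rewrite ltninfty_adde_def// inE kl_term_gtNy.
  rewrite expeRD EFinM muleACA EFinM.
  by apply: lee_pmul; rewrite ?mule_ge0 ?lee_fin ?exprn_ge0 ?expeR_ge0 ?subr_ge0//;
    apply: expeR_kl_term_le => //; rewrite ?leq_subr ?subr_ge0.
by rewrite /xi; under [in leRHS]eq_bigr do rewrite -mulrA.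
Qed.

End MaurerBound.

(** * Good samples, by Tonelli and Markov *)

Section PacBayesEvent.
Context {R : realType} {d dW : measure_display}.
Context {T : measurableType d} {W : measurableType dW}.
Variables (D : probability T R) (P : probability W R) (F : W * T -> R).
Hypotheses (mF : measurable_fun [set: (W * T)%type] F)
  (F01 : forall x, 0 <= F x <= 1).

Lemma measurable_mean :
  measurable_fun [set: W] (fun w => fine (\int[D]_z (F (w, z))%:E)).
Proof.
apply: measurableT_comp; first exact: fine_measurable.
apply: (measurable_fun_fubini_tonelli_F (EFin \o F)); first exact/measurable_EFinP.
by move=> x /=; rewrite lee_fin; case/andP: (F01 x).
Qed.

Lemma measurable_sample_mean (dV : measure_display) (V : measurableType dV) m
    (u : V -> W) (t : V -> m.-tuple T) :
    measurable_fun [set: V] u -> measurable_fun [set: V] t ->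
  measurable_fun [set: V]
    (fun v => m%:R^-1 * \sum_(i < m) F (u v, tnth (t v) i)).
Proof.
move=> mu mt; apply: measurable_funM => //; apply: measurable_sum => i.
apply: (measurableT_comp mF); apply: measurable_fun_pair => //.
by apply: (measurableT_comp (measurable_tnth i)).
Qed.

(** The event is defined through the prior [P] alone, so it serves all posteriors at once. *)
Lemma pac_bayes_event m (delta : R) : (0 < m)%N -> 0 < delta ->
  exists E : set (m.-tuple T),
    [/\ measurable E, ((1 - delta)%:E <= iid D m E)%E &
        forall S, E S ->
        (\int[P]_w expeR (m%:R%:E * kl (m%:R^-1 * \sum_(i < m) F (w, tnth S i))
                                       (fine (\int[D]_z (F (w, z))%:E)))
         <= (xi R m / delta)%:E)%E].
Proof.
move=> m0 d0; have xi0 : 0 < xi R m by apply: lt_le_trans (xi_ge1 R m m0).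
pose K := xi R m / delta; have K0 : 0 < K by rewrite divr_gt0.
pose phi (Sw : m.-tuple T * W) := expeR
  (m%:R%:E * kl (m%:R^-1 * \sum_(i < m) F (Sw.2, tnth Sw.1 i))
                (fine (\int[D]_z (F (Sw.2, z))%:E))).
have phi0 Sw : (0 <= phi Sw)%E by exact: expeR_ge0.
have mFw w : measurable_fun [set: T] (fun z => F (w, z)).
  by apply: (measurableT_comp mF); exact: measurable_pair1.
have mphi : measurable_fun [set: (m.-tuple T * W)%type] phi.
  apply: measurable_fun_expeR; apply: emeasurable_funM => //.
  apply: measurable_kl.
  - exact: measurable_sample_mean.
  - by apply: (measurableT_comp measurable_mean).
  - by move=> Sw; exact: (sample_mean01 m m0 (fun z => F (Sw.2, z))).
  - by move=> Sw; apply: mean01.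
pose G S := (\int[P]_w phi (S, w))%E.
have mG : measurable_fun [set: m.-tuple T] G.
  exact: (measurable_fun_fubini_tonelli_F phi).
have G0 S : (0 <= G S)%E by apply: integral_ge0.
(* Tonelli puts the sample integral inside, where Maurer's bound holds for each fixed [w]. *)
have EG : (\int[iid D m]_S G S <= (xi R m)%:E)%E.
  rewrite /G (fubini_tonelli phi)//.
  rewrite -[leRHS](integral_cst_prob R dW W P); apply: ge0_le_integral => //.
  - by move=> w _; apply: integral_ge0.
  - exact: (measurable_fun_fubini_tonelli_G phi).
  - move=> w _; exact: (integral_expeR_kl_le D m m0 (fun z => F (w, z))).
pose B := [set S | (K%:E <= `|G S|)%E].
have mB : measurable B.
  rewrite -[B]setTI; apply: emeasurable_fun_c_infty => //.
  exact: measurableT_comp.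
exists (~` B); split; first exact: measurableC.
  rewrite probability_setC// EFinB; apply: leeB => //.
  (* Markov's inequality at level [K]; since [K * delta = xi R m], the bad event [B] has probability
     at most [delta]. *)
  have := le_integral_comp_abse (iid D m) measurableT
    (@measurable_id _ _ _) (fun r r0 => r0) (fun x y _ _ => id) mG K0.
  rewrite setTI => markov.
  have : (K%:E * iid D m B <= K%:E * delta%:E)%E.
    apply: le_trans markov _; rewrite -EFinM divfK ?gt_eqF//.
    by apply: le_trans EG; under eq_integral do rewrite gee0_abs//.
  by rewrite lee_pmul2l.
move=> S /= /negP; rewrite -ltNge gee0_abs// => /ltW; exact.
Qed.

End PacBayesEvent.

(** * Densities and Gibbs' variational inequality *)

Section ChangeOfMeasure.
Context {R : realType} {d : measure_display} {T : measurableType d}.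
Variables (P : probability T R).

Lemma density_integrable (Q : probability T R) (q : T -> R) :
  is_density P Q q -> P.-integrable [set: T] (EFin \o q).
Proof.
move=> [mq q0 Qq]; apply/integrableP; split; first exact/measurable_EFinP.
under eq_integral do rewrite /= ger0_norm//.
have := Qq _ measurableT; rewrite (_ : Q setT = 1%E) => [<-|]; first by rewrite ltry.
exact: probability_setT.
Qed.

(** A density forces [Q] to be dominated by [P] and agrees almost everywhere with the Radon-Nikodym
    derivative, so the change of variables for the latter carries over. *)
Lemma integral_density (Q : probability T R) (q : T -> R) (f : T -> \bar R) :
    is_density P Q q -> Q.-integrable [set: T] f ->
  (\int[Q]_x f x = \int[P]_x (f x * (q x)%:E))%E.
Proof.
move=> Hq intf; have [mq q0 Qq] := Hq.
have iq := density_integrable Q q Hq.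
have QP : null_dominates P Q.
  apply/null_content_dominatesP => A mA PA0.
  rewrite Qq// null_set_integral//.
  by apply: (measurable_funS measurableT) => //; exact/measurable_EFinP.
rewrite -(Radon_Nikodym_change_of_variables QP measurableT intf).
have QPc : null_dominates P (charge_of_finite_measure Q) by [].
have iRN := Radon_Nikodym_integrable QPc.
have mRN := measurable_int _ iRN.
apply: ae_eq_integral => //.
- by apply: emeasurable_funM => //; exact: measurable_int intf.
- by apply: emeasurable_funM; [exact: measurable_int intf|exact/measurable_EFinP].
apply: ae_eqe_mul2l; apply: integral_ae_eq => //.
- exact/measurable_EFinP.
by move=> A _ mA; rewrite -Radon_Nikodym_integral//= -Qq.
Qed.

(* Gibbs' variational inequality: [log u <= u - 1] at [u = exp L / (rho K)]. *)
Lemma donsker_varadhan (rho L : T -> R) (K : R) :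
    (forall x, 0 <= rho x) -> P.-integrable [set: T] (EFin \o rho) ->
    \int[P]_x rho x = 1 ->
    P.-integrable [set: T] (fun x => (rho x * L x)%:E) ->
    P.-integrable [set: T] (fun x => (rho x * ln (rho x))%:E) ->
    measurable_fun [set: T] L -> 0 < K ->
    (\int[P]_x (expR (L x))%:E <= K%:E)%E ->
  \int[P]_x (rho x * L x) <= \int[P]_x (rho x * ln (rho x)) + ln K.
Proof.
move=> rho0 irho rho1 irhoL ient mL K0 expL.
have iexp : P.-integrable [set: T] (EFin \o (fun x => expR (L x))).
  apply/integrableP; split.
    by apply/measurable_EFinP; apply: measurableT_comp.
  under eq_integral do rewrite /= ger0_norm ?expR_ge0//.
  by apply: le_lt_trans expL _; rewrite ltry.
have iexpK := integrableZl measurableT K^-1 iexp.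
have irhoK := integrableZl measurableT (1 - ln K) irho.
have iLE := integrableB measurableT irhoL ient.
(* The pointwise inequality is integrated: as [rho] has mass 1, the left side is the wanted
   difference plus [1 - ln K], and the right side is at most 1. *)
have := @le_Rintegral _ _ _ P setT
  (fun x => (rho x * L x - rho x * ln (rho x)) + (1 - ln K) * rho x)
  (fun x => K^-1 * expR (L x)) measurableT.
rewrite RintegralD// RintegralB// !RintegralZl// rho1 mulr1.
move=> /(_ (integrableD measurableT iLE irhoK) iexpK) H.
have : K^-1 * \int[P]_x expR (L x) <= 1.
  rewrite ler_pdivrMl// mulr1 -lee_fin /Rintegral fineK//.
  exact: integrable_fin_num iexp.
suff /H : forall x, [set: T] x ->
    rho x * L x - rho x * ln (rho x) + (1 - ln K) * rho x <= K^-1 * expR (L x).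
  lra.
move=> x _; have := rho0 x; rewrite le_eqVlt => /predU1P[<-|r0].
  by rewrite !mul0r mulr0 subrr addr0 mulr_ge0 ?expR_ge0// invr_ge0 ltW.
have := @ln_le_sub1 R (K^-1 * expR (L x) / rho x).
rewrite !(ln_div, lnM, lnV) ?posrE ?divr_gt0 ?mulr_gt0 ?invr_gt0 ?expR_gt0//.
rewrite expRK => /(_ isT) /(ler_wpM2l (ltW r0)).
have -> : rho x * (K^-1 * expR (L x) / rho x - 1) = K^-1 * expR (L x) - rho x.
  by field; rewrite !gt_eqF.
lra.
Qed.

End ChangeOfMeasure.

(** * Integrals of tensor products *)

Section TensorIntegral.
Context {R : realType} {d : measure_display} {T : measurableType d}.
Variables (P : probability T R) (u v : T -> R).
Hypotheses (iu : P.-integrable [set: T] (EFin \o u))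
  (iv : P.-integrable [set: T] (EFin \o v)).

Lemma integrable_tensor :
  (P \x P)%E.-integrable [set: (T * T)%type] (fun w => (u w.1 * v w.2)%:E).
Proof.
have /measurable_EFinP mu := measurable_int _ iu.
have /measurable_EFinP mv := measurable_int _ iv.
apply/integrable12ltyP.
  apply/measurable_EFinP; apply: measurable_funM.
    exact: (measurableT_comp mu).
  exact: (measurableT_comp mv).
have /integrableP[_ fu] := iu; have /integrableP[_ fv] := iv.
under eq_integral => x _.
  under eq_integral do rewrite /= normrM EFinM.
  rewrite ge0_integralZl//; last first.
    by apply/measurable_EFinP; exact: measurableT_comp.
  over.
rewrite ge0_integralZr//; last 2 first.
- by apply/measurable_EFinP; exact: measurableT_comp.
- exact: integral_ge0.
have u0 : (0 <= \int[P]_x `|(u x)%:E|)%E by exact: integral_ge0.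
by apply: lte_mul_pinfty => //; rewrite ge0_fin_numE.
Qed.

Lemma Rintegral_tensor :
  \int[(P \x P)%E]_w (u w.1 * v w.2) = \int[P]_x u x * \int[P]_x v x.
Proof.
rewrite /Rintegral -fineM; [|exact: integrable_fin_num iu|exact: integrable_fin_num iv].
congr fine; rewrite -(integral12_prod_meas1 integrable_tensor) /fubini_F /=.
have fv := integrable_fin_num measurableT iv.
under eq_integral do rewrite (integralZl measurableT iv)// -(fineK fv).
by rewrite -(fineK fv) (integralZr measurableT iu).
Qed.

End TensorIntegral.

(** * From the prior on pairs to all posteriors *)

Section PosteriorBound.
Context {R : realType} {d : measure_display} {H : measurableType d}.
Variables (P Q : probability H R).

(** The negative part of [q * ln q] is at most 1, so only the positive part could diverge, and the
    hypothesis excludes that. *)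
Lemma integrable_density_ln (q : H -> R) : is_density P Q q ->
    (\int[P]_f (q f * ln (q f))%:E < +oo)%E ->
  P.-integrable [set: H] (fun f => (q f * ln (q f))%:E).
Proof.
move=> [mq q0 _]; set F := fun f => _.
have mF : measurable_fun [set: H] F.
  by apply/measurable_EFinP; apply: measurable_funM => //; exact: measurableT_comp.
have Fneg f : (F^\- f <= 1)%E.
  rewrite funenegE ge_max lee01 andbT -EFinN lee_fin.
  have := q0 f; rewrite le_eqVlt => /predU1P[<-|r0]; first by rewrite mul0r oppr0.
  have := @ln_le_sub1 R (q f)^-1; rewrite invr_gt0 lnV ?posrE// => /(_ r0).
  move=> /(ler_wpM2l (ltW r0)); rewrite mulrN mulrBr mulfV ?gt_eqF//; lra.
have mFn := measurable_funeneg mF; have mFp := measurable_funepos mF.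
have iFneg : (\int[P]_f F^\- f <= 1)%E.
  rewrite -[leRHS](integral_cst_prob R d H P).
  by apply: ge0_le_integral.
have Fn0 : (0 <= \int[P]_f F^\- f)%E by exact: integral_ge0.
have Fp0 : (0 <= \int[P]_f F^\+ f)%E by exact: integral_ge0.
rewrite integralE => Flty; apply/integrableP; split=> //.
have -> : (fun f => `|F f|)%E = (fun f => F^\+ f + F^\- f)%E.
  exact: (fune_abse F).
rewrite ge0_integralD//.
have Fnlty : (\int[P]_f F^\- f < +oo)%E by apply: le_lt_trans iFneg _; rewrite ltry.
apply: lte_add_pinfty => //; rewrite ltNge leye_eq; apply/negP => /eqP Fpy.
by move: Flty; rewrite Fpy addye// eqe_oppLR/= lt_eqF.
Qed.

(** The density of [Q x Q] with respect to [P x P] is the tensor square of [q], which also dominates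
    the integrand because [g] is at most 1. *)
Lemma integral_posterior2 (q : H -> R) (g : H * H -> R) :
    is_density P Q q -> measurable_fun [set: (H * H)%type] g ->
    (forall w, 0 <= g w <= 1) ->
  (P \x P)%E.-integrable [set: (H * H)%type]
    (fun w => (q w.1 * q w.2 * g w)%:E) /\
  fine (\int[Q]_f1 \int[Q]_f2 (g (f1, f2))%:E)%E =
    \int[(P \x P)%E]_w (q w.1 * q w.2 * g w).
Proof.
move=> Hq mg g01; have [mq q0 _] := Hq; have iq := density_integrable P Q q Hq.
have g0 w : 0 <= g w by case/andP: (g01 w).
have mqq : measurable_fun [set: (H * H)%type] (fun w => q w.1 * q w.2).
  by apply: measurable_funM; exact: (measurableT_comp mq).
have mqqg : measurable_fun [set: (H * H)%type] (fun w => q w.1 * q w.2 * g w).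
  exact: measurable_funM.
split.
  apply: le_integrable (integrable_tensor P q q iq iq) => //.
    exact/measurable_EFinP.
  move=> w _ /=; rewrite lee_fin !ger0_norm ?mulr_ge0//.
  by rewrite ler_piMr ?mulr_ge0//; case/andP: (g01 w).
have mgf f1 : measurable_fun [set: H] (fun f2 => g (f1, f2)).
  by apply: (measurableT_comp mg); exact: measurable_pair1.
have int01 (u : H -> \bar R) : measurable_fun [set: H] u ->
    (forall f, (0 <= u f <= 1)%E) -> Q.-integrable [set: H] u.
  move=> mu u01; apply/integrableP; split => //.
  apply: (@le_lt_trans _ _ 1%E); last by rewrite ltry.
  rewrite -[leRHS](integral_cst_prob R d H Q); apply: ge0_le_integral => //.
    exact: measurableT_comp.
  by move=> f _; rewrite gee0_abs; case/andP: (u01 f).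
congr fine.
rewrite (integral_density P Q q)//; last first.
  apply: int01.
    apply: (measurable_fun_fubini_tonelli_F (EFin \o g)) => //; exact/measurable_EFinP.
  move=> f1; rewrite integral_ge0/=; last by move=> f _; rewrite lee_fin.
  rewrite -[leRHS](integral_cst_prob R d H Q); apply: ge0_le_integral => //.
  - by move=> f _; rewrite lee_fin.
  - exact/measurable_EFinP.
  - by move=> f _; rewrite lee_fin; case/andP: (g01 (f1, f)).
rewrite (fubini_tonelli1 (fun w => (q w.1 * q w.2 * g w)%:E)); last 2 first.
- exact/measurable_EFinP.
- by move=> w; rewrite lee_fin !mulr_ge0.
apply: eq_integral => f1 _; rewrite /fubini_F /=.
rewrite (integral_density P Q q)//; last first.
  apply: int01; first exact/measurable_EFinP.
  by move=> f; rewrite !lee_fin.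
rewrite -ge0_integralZr//; last 3 first.
- by apply: emeasurable_funM; exact/measurable_EFinP.
- by move=> f _; rewrite -EFinM lee_fin mulr_ge0.
- by rewrite lee_fin.
by apply: eq_integral => f2 _; rewrite -!EFinM; congr EFin; ring.
Qed.

Lemma kl_posterior_le m (A B : H * H -> R) (K : R) : (0 < m)%N -> 0 < K ->
    measurable_fun [set: (H * H)%type] A -> (forall w, 0 <= A w <= 1) ->
    measurable_fun [set: (H * H)%type] B -> (forall w, 0 <= B w <= 1) ->
    (\int[(P \x P)]_w expeR (m%:R%:E * kl (A w) (B w)) <= K%:E)%E ->
  (kl (fine (\int[Q]_f1 \int[Q]_f2 (A (f1, f2))%:E))
      (fine (\int[Q]_f1 \int[Q]_f2 (B (f1, f2))%:E))
   <= m%:R^-1%:E * (2%:E * KL Q P + (ln K)%:E))%E.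
Proof.
move=> m0 K0 mA A01 mB B01 expK; set a := fine _; set b := fine _.
have m0R : 0 < m%:R :> R by rewrite ltr0n.
have mean01' (g : H * H -> R) : measurable_fun [set: (H * H)%type] g ->
    (forall w, 0 <= g w <= 1) ->
    0 <= fine (\int[Q]_f1 \int[Q]_f2 (g (f1, f2))%:E)%E <= 1.
  move=> mg g01.
  rewrite -(fubini_tonelli1 (EFin \o g)); first exact: (mean01 (Q \x Q)%E).
    exact/measurable_EFinP.
  by move=> w; rewrite lee_fin; case/andP: (g01 w).
have a01 : 0 <= a <= 1 by exact: mean01'.
have b01 : 0 <= b <= 1 by exact: mean01'.
(* The inequality is solved for [KL Q P], an infimum, so that it can be proved for one density at a
   time; without any density the infimum is [+oo]. *)
have bound r s : 0 < r -> 0 < s ->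
    (((m%:R * kl_dual R r s a b - ln K) / 2)%:E <= KL Q P)%E.
  move=> r0 s0; apply: le_ereal_inf_tmp => _ [q [Hq ->]].
  have [->|vlty] := eqVneq (\int[P]_f (q f * ln (q f))%:E)%E +oo%E.
    by rewrite leey.
  have ient : P.-integrable [set: H] (fun f => (q f * ln (q f))%:E).
    by apply: integrable_density_ln; rewrite // ltey.
  have iq := density_integrable P Q q Hq.
  have [mq q0 Qq] := Hq.
  have q1 : \int[P]_f q f = 1.
    by rewrite /Rintegral -(Qq _ measurableT) probability_setT.
  have iqq := integrable_tensor P q q iq iq.
  have [iA EA] := integral_posterior2 q A Hq mA A01.
  have [iB EB] := integral_posterior2 q B Hq mB B01.
  have ie1 := integrable_tensor P _ q ient iq.
  have ie2 := integrable_tensor P q _ iq ient.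
  pose rho (w : H * H) := q w.1 * q w.2.
  pose L (w : H * H) := m%:R * kl_dual R r s (A w) (B w).
  (* Coefficients of [m * kl_dual] as an affine form in [(A, B)]. *)
  pose cA := m%:R * (ln r - ln s); pose cB := m%:R * (s - r).
  pose c := m%:R * (1 + ln s - s).
  have rhoL : (fun w => rho w * L w) = (fun w => c * (q w.1 * q w.2) +
      cA * (q w.1 * q w.2 * A w) + cB * (q w.1 * q w.2 * B w)).
    apply/funext => w; rewrite /rho /L mul_kl_dualE /c /cA /cB; ring.
  (* The logarithm of the product splits where both factors are positive; elsewhere both sides are
     0. Each summand integrates to the same entropy, whence the factor 2. *)
  have rholn : (fun w => rho w * ln (rho w)) = (fun w =>
      q w.1 * ln (q w.1) * q w.2 + q w.1 * (q w.2 * ln (q w.2))).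
    apply/funext => w; rewrite /rho.
    have := q0 w.1; rewrite le_eqVlt => /predU1P[<-|q10]; first by rewrite !mul0r addr0.
    have := q0 w.2; rewrite le_eqVlt => /predU1P[<-|q20]; first by rewrite !(mul0r, mulr0) addr0.
    by rewrite lnM//; ring.
  have iZ u (z : R) := @integrableZl _ _ _ (P \x P)%E setT measurableT z u.
  have irhoL : (P \x P)%E.-integrable setT (fun w => (rho w * L w)%:E).
    have -> : (fun w => (rho w * L w)%:E) = EFin \o (fun w => rho w * L w) by [].
    rewrite rhoL; exact: (integrableD measurableT
      (integrableD measurableT (iZ _ c iqq) (iZ _ cA iA)) (iZ _ cB iB)).
  have irholn : (P \x P)%E.-integrable setT (fun w => (rho w * ln (rho w))%:E).
    have -> : (fun w => (rho w * ln (rho w))%:E) = EFin \o (fun w => rho w * ln (rho w)) by [].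
    by rewrite rholn; exact: (integrableD measurableT ie1 ie2).
  have mL : measurable_fun [set: (H * H)%type] L.
    have -> : L = fun w => c + cA * A w + cB * B w.
      by apply/funext => w; rewrite /L mul_kl_dualE /c /cA /cB; ring.
    by apply: measurable_funD; first apply: measurable_funD => //;
      exact: measurable_funM.
  have expL : (\int[(P \x P)]_w (expR (L w))%:E <= K%:E)%E.
    apply: le_trans expK; apply: ge0_le_integral => //.
    - by apply/measurable_EFinP; exact: measurableT_comp.
    - apply: measurable_fun_expeR; apply: emeasurable_funM => //.
      exact: measurable_kl.
    - move=> w _; rewrite -/(expeR (L w)%:E) lee_expeR /L EFinM.
      by rewrite lee_wpmul2l ?lee_fin ?ler0n// kl_dual_le.
  have rho0 w : 0 <= rho w by rewrite mulr_ge0.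
  have rho1 : \int[(P \x P)%E]_w rho w = 1.
    by rewrite (Rintegral_tensor P q q iq iq) q1 mulr1.
  have := donsker_varadhan (P \x P)%E rho L K rho0 iqq rho1 irhoL irholn mL K0 expL.
  rewrite rhoL rholn !RintegralD//; first last.
  - exact: iZ iB.
  - exact: (integrableD measurableT (iZ _ c iqq) (iZ _ cA iA)).
  - exact: iZ iA.
  - exact: iZ iqq.
  (* Linearity moves the integral inside the affine form, which takes the place of Jensen's
     inequality. *)
  rewrite !RintegralZl// -EA -EB -/a -/b rho1.
  rewrite (Rintegral_tensor P _ q ient iq) (Rintegral_tensor P q _ iq ient) q1.
  rewrite !mulr1 mul1r => dv.
    rewrite -[leRHS]fineK; last exact: integrable_fin_num ient.
  rewrite lee_fin ler_pdivrMr// -/(Rintegral P setT (fun f => q f * ln (q f))).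
  rewrite mul_kl_dualE; move: dv; rewrite /c /cA /cB; lra.
apply: kl_le_dual => // r s r0 s0; have := bound r s r0 s0.
rewrite lee_pdivlMl//; case: (KL Q P) => [v| |]//.
- by rewrite -!EFinM -EFinD !lee_fin ler_pdivrMr//; lra.
- by move=> _; rewrite gt0_muley ?lte_fin// addye// leey.
Qed.


End PosteriorBound.

(** * The three joint risks as bounded measurable functions *)

Section RiskIntegrand.
Context {R : realType} {dX dH : measure_display}.
Context {X : measurableType dX} {H : measurableType dH}.
Variables (h : H -> X -> R) (k : risk_kind).

Definition joint_risk (x : (H * H) * (X * bool)) : R :=
  risk_integrand h k x.1.1 x.1.2 x.2.

(** The linear loss of a vote in [-1,1] lies in [0,1], and so do its complement and products of such
    values; for the disagreement, the product of two votes is again in [-1,1]. *)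
Lemma joint_risk01 : (forall f x, -1 <= h f x <= 1) ->
  forall x, 0 <= joint_risk x <= 1.
Proof.
move=> h1 [[f1 f2] [x y]]; rewrite /joint_risk /=.
have /andP[a0 a1] := h1 f1 x; have /andP[b0 b1] := h1 f2 x.
have loss01 a : -1 <= a -> a <= 1 -> 0 <= linloss a (lab R y) <= 1.
  by rewrite /linloss /lab; case: y => ? ?; apply/andP; split; lra.
have /andP[l0 l1] := loss01 _ a0 a1; have /andP[l0' l1'] := loss01 _ b0 b1.
case: k => /=; first by rewrite mulr_ge0// mulr_ile1.
  by rewrite mulr_ge0 ?mulr_ile1 ?subr_ge0 ?lerBlDr ?lerDl.
rewrite /linloss mul1r; apply/andP; split; nra.
Qed.

Lemma measurable_joint_risk :
    measurable_fun [set: (H * X)%type] (fun p => h p.1 p.2) ->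
  measurable_fun [set: ((H * H) * (X * bool))%type] joint_risk.
Proof.
move=> mh; pose T := ((H * H) * (X * bool))%type.
have m1 : measurable_fun [set: T] (fun x => h x.1.1 x.2.1).
  apply: (measurableT_comp mh (g := fun x : T => (x.1.1, x.2.1))).
  by apply: measurable_fun_pair; exact: measurableT_comp.
have m2 : measurable_fun [set: T] (fun x => h x.1.2 x.2.1).
  apply: (measurableT_comp mh (g := fun x : T => (x.1.2, x.2.1))).
  by apply: measurable_fun_pair; exact: measurableT_comp.
have mlab : measurable_fun [set: T] (fun x => lab R x.2.2).
  by apply: measurable_fun_ifT => //; exact: measurableT_comp.
have mloss (u v : T -> R) : measurable_fun [set: T] u ->
    measurable_fun [set: T] v ->
    measurable_fun [set: T] (fun x => linloss (u x) (v x)).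
  move=> mu mv; apply: measurable_funM => //; apply: measurable_funB => //.
  exact: measurable_funM.
rewrite /joint_risk; case: k => /=.
- by apply: measurable_funM; exact: mloss.
- by apply: measurable_funM; apply: measurable_funB => //; exact: mloss.
- by apply: mloss => //; exact: measurable_funM.
Qed.

End RiskIntegrand.

Theorem mainTheorem10 (R : realType)
    (dX : measure_display) (X : measurableType dX)
    (dH : measure_display) (H : measurableType dH)
    (h : H -> X -> R)
    (h_meas : measurable_fun [set: (H * X)%type] (fun p => h p.1 p.2))
    (h_range : forall f x, -1 <= h f x <= 1)
    (D : probability ((X * bool)%type) R) (P : probability H R)
    (delta : R) (delta_range : 0 < delta <= 1)
    (m : nat) (m_pos : (0 < m)%N) (k : risk_kind) :
  exists E : set (m.-tuple ((X * bool)%type)),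
    [/\ measurable E,
        ((1 - delta)%:E <= prodD D m E)%E &
        forall S, E S -> forall Q : probability H R,
          (kl (alpha h k Q (expS S)) (alpha h k Q (expD D))
           <= (m%:R^-1)%:E * (2%:E * KL Q P + (ln (xi R m / delta))%:E))%E].
Proof.
have mF := measurable_joint_risk h k h_meas.
have F01 := joint_risk01 h k h_range.
have [delta0 _] := andP delta_range.
(* The parameter space is the set of pairs of voters, with prior [P x P]. *)
have [E [mE DE HE]] :=
  pac_bayes_event D (P \x P)%E (joint_risk h k) mF F01 m delta m_pos delta0.
exists E; split => //; first by rewrite prodD_iid.
move=> S ES Q.
have K0 : 0 < xi R m / delta.
  by rewrite divr_gt0// (lt_le_trans ltr01)// xi_ge1.
apply: (kl_posterior_le P Q m
  (fun w => expS S (fun z => joint_risk h k (w, z)))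
  (fun w => expD D (fun z => joint_risk h k (w, z)))) => //.
(* The constant map [cst S] specializes joint measurability to the fixed sample. *)
- exact: (measurable_sample_mean _ mF _ _ m id (cst S)).
- by move=> w; exact: (sample_mean01 m m_pos (fun z => joint_risk h k (w, z))).
- exact: measurable_mean.
- move=> w; apply: (mean01 D (fun z => joint_risk h k (w, z))) => //.
  by apply: (measurableT_comp mF); exact: measurable_pair1.
- exact: HE.
Qed.
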